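(* Let $(\alpha,\omega,\beta)$ be an irreducible feasible endpoint constraint for which equality holds in $\sum_{i=0}^Ii\omega_i+(I+1)\omega_{I+}\le\sum_{k}k\alpha_k+\beta$, and let $\pi^*$ be the unique minimizer of $\sum_{k\in\mathcal{K}}\alpha_kD(\pi_{(k)}\|\mathcal{P}(\beta))$ subject to $\sum_{k\in\mathcal{K}}\alpha_k\sum_jj\pi_{k,j}=\beta$ and $\omega_i=\sum_{k\le i,k\in\mathcal{K}}\alpha_k\pi_{k,i-k}$ ($0\le i\le I$). Then there exist positive constants $\{D_k\}_{k\in\mathcal{K}}$ and $\{W_i\}_{i\in\mathcal{I}(\omega)}$ such that $$\pi^*_{k,j}=\begin{cases}D_k\mathcal{P}_j(\beta)W_{k+j},& k\in\mathcal{K},\ k+j\in\mathcal{I}(\omega),\\ 0,&\text{otherwise.}\end{cases}$$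
   Context: Fix $I\ge0$, $\beta>0$. $\alpha,\omega\in S_I=\{\gamma\in\mathbb{R}^{I+2}:\gamma_j\ge0,\sum\gamma_j=1\}$, components $\alpha_0,\dots,\alpha_{I+1}$ ($\alpha_0>0$), $\omega_0,\dots,\omega_I,\omega_{I+}$. $\mathcal{K}=\{k:\alpha_k>0\}$. Feasible: $\sum_{j\le i}\alpha_j\ge\sum_{j\le i}\omega_j$ ($i=0,\dots,I$) and $\sum_{i=0}^Ii\omega_i+(I+1)\omega_{I+}\le\sum_kk\alpha_k+\beta$; irreducible: the first inequalities strict for $i<I$. Standing convention of the paper: in the equality (polynomial) case the problem is formulated (replacing $I$ by $I+1$ if needed) so that $\omega_{I+}=0$. $\pi_{(k)}=(\pi_{k,j})_{j\ge0}$ are probability distributions on the nonnegative integers; $\mathcal{P}_j(t)=e^{-t}t^j/j!$; $D$ is relative entropy. $\mathcal{I}(\omega)$: integers $i\ge0$ with $i\le I,\omega_i>0$, or $i>I,\omega_{I+}>0$. *)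

(* Defs.v *)
From HB Require Import structures.
From mathcomp Require Import all_boot all_order all_algebra.
From mathcomp Require Import all_classical all_reals all_analysis.
Set Implicit Arguments. Unset Strict Implicit. Unset Printing Implicit Defensive.
Import Order.TTheory GRing.Theory Num.Theory.
Local Open Scope ring_scope.

(* Vectors in S_I are functions 'I_(I+2) -> R.  For alpha, index k is alpha_k
   (k = 0..I+1).  For omega, index i <= I is omega_i and index I+1 (ord_max)
   is omega_{I+}. *)

Definition in_simplex (R : realType) (I : nat) (g : 'I_I.+2 -> R) : Prop :=
  (forall j, 0 <= g j) /\ \sum_(j < I.+2) g j = 1.

Definition cum_ineq (R : realType) (I : nat) (a w : 'I_I.+2 -> R) : Prop :=
  forall i : 'I_I.+2, (i <= I)%N ->
    \sum_(j < I.+2 | (j <= i)%N) w j <= \sum_(j < I.+2 | (j <= i)%N) a j.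

Definition w_moment (R : realType) (I : nat) (w : 'I_I.+2 -> R) : R :=
  \sum_(i < I.+2) (i%:R * w i).

Definition a_moment (R : realType) (I : nat) (a : 'I_I.+2 -> R) : R :=
  \sum_(k < I.+2) (k%:R * a k).

Definition feasible (R : realType) (I : nat) (a w : 'I_I.+2 -> R) (b : R) : Prop :=
  cum_ineq a w /\ w_moment w <= a_moment a + b.

Definition irreducible (R : realType) (I : nat) (a w : 'I_I.+2 -> R) : Prop :=
  forall i : 'I_I.+2, (i < I)%N ->
    \sum_(j < I.+2 | (j <= i)%N) w j < \sum_(j < I.+2 | (j <= i)%N) a j.

(* Poisson pmf P_j(t): we use the library's poisson_pmf, which equals
   t^j / j! * e^{-t} whenever t > 0. *)

(* relative entropy D(p || q) = sum_j p_j log(p_j/q_j) (convention 0 log 0 = 0,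
   which holds since ln 0 = 0 in mathcomp-analysis), defined as
   (sum of positive parts) - (sum of negative parts) in the extended reals. *)
Definition kl_term (R : realType) (x y : R) : R := x * ln (x / y).

Definition rel_entropy (R : realType) (p q : nat -> R) : \bar R :=
  (\sum_(j <oo) (Num.max (kl_term (p j) (q j)) 0)%:E
   - \sum_(j <oo) (Num.max (- kl_term (p j) (q j)) 0)%:E)%E.

Definition prob_nat (R : realType) (p : nat -> R) : Prop :=
  (forall j, 0 <= p j) /\ (\sum_(j <oo) (p j)%:E = 1%E)%E.

Definition nat_mean (R : realType) (p : nat -> R) : \bar R :=
  (\sum_(j <oo) (j%:R * p j)%:E)%E.

Definition objective (R : realType) (I : nat) (a : 'I_I.+2 -> R) (b : R)
  (pi : 'I_I.+2 -> nat -> R) : \bar R :=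
  (\sum_(k < I.+2 | (0 < a k)%R) (a k)%:E * rel_entropy (pi k) (poisson_pmf b))%E.

Definition admissible (R : realType) (I : nat) (a w : 'I_I.+2 -> R) (b : R)
  (pi : 'I_I.+2 -> nat -> R) : Prop :=
  [/\ forall k, 0 < a k -> prob_nat (pi k),
      (\sum_(k < I.+2 | (0 < a k)%R) (a k)%:E * nat_mean (pi k) = b%:E)%E
    & forall i : 'I_I.+2, (i <= I)%N ->
        w i = \sum_(k < I.+2 | (0 < a k) && (k <= i)%N) a k * pi k (i - k)%N].

Definition is_minimizer (R : realType) (I : nat) (a w : 'I_I.+2 -> R) (b : R)
  (pi : 'I_I.+2 -> nat -> R) : Prop :=
  admissible a w b pi /\
  forall pi', admissible a w b pi' -> (objective a b pi <= objective a b pi')%E.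

Definition is_unique_minimizer (R : realType) (I : nat) (a w : 'I_I.+2 -> R) (b : R)
  (pi : 'I_I.+2 -> nat -> R) : Prop :=
  is_minimizer a w b pi /\
  forall pi', is_minimizer a w b pi' -> forall k, 0 < a k -> pi' k = pi k.

Definition in_Iw (R : realType) (I : nat) (w : 'I_I.+2 -> R) (i : nat) : bool :=
  ((i <= I)%N && (0 < w (inord i))) || ((I < i)%N && (0 < w ord_max)).

(* Main.v *)
Require Import Defs.
From HB Require Import structures.
From mathcomp Require Import all_boot all_order all_algebra.
From mathcomp Require Import all_classical all_reals all_analysis.
From mathcomp Require Import ring lra.
Import Order.TTheory GRing.Theory Num.Theory.
Local Open Scope ring_scope.

(** In terms of the joint masses x_{k,i} = alpha_k pi_{k,i-k}, an admissible
  family is a matrix supported on k <= i <= I with row sums alpha and column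
  sums omega: since omega_{I+} = 0, the support and the mean constraint come for
  free.  The objective becomes the relative entropy of x with respect to
  alpha_k P_{i-k}(beta).  Irreducibility leaves room for such a matrix that is
  positive wherever alpha_k, omega_i > 0 and k <= i (a small multiple of the
  product matrix plus a quantile coupling of what remains), and the infinite
  slope of t ln t at 0 forces the minimizer to be positive there as well.  A
  positive minimizer is stationary along the exchanges between the rows 0, k and
  the columns i, I, which stay in the triangle because alpha_0 > 0 and
  omega_I > 0; this says that x_{k,i} / (alpha_k P_{i-k}(beta)) has rank one. *)

(** * Triangular plans with prescribed row and column sums *)

Definition upper_plan {R : realType} (n : nat) (a w : nat -> R)
    (x : nat -> nat -> R) : Prop :=
  [/\ forall k i, 0 <= x k i,
      forall k i, ~~ (k <= i < n)%N -> x k i = 0,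
      forall k, (k < n)%N -> \sum_(i < n) x k i = a k
    & forall i, (i < n)%N -> \sum_(k < n) x k i = w i].

Lemma psum_le {R : realType} (a : nat -> R) (m n : nat) :
  (forall k, 0 <= a k) -> (m <= n)%N -> \sum_(j < m) a j <= \sum_(j < n) a j.
Proof.
move=> a0 mn; rewrite -(subnKC mn) big_split_ord /= lerDl.
by apply: sumr_ge0.
Qed.

(* The quantile coupling: mass is moved monotonically, and
   [min W A] is the joint distribution function. *)
Lemma upper_plan_exists {R : realType} (n : nat) (a w : nat -> R) :
  (forall k, 0 <= a k) -> (forall i, 0 <= w i) ->
  (forall m, (m <= n)%N -> \sum_(j < m) w j <= \sum_(j < m) a j) ->
  \sum_(j < n) w j = \sum_(j < n) a j ->
  exists x, upper_plan n a w x.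
Proof.
move=> a0 w0 le_wa eq_wa.
pose A m := \sum_(j < m) a j; pose W m := \sum_(j < m) w j.
have AS m : A m.+1 = A m + a m by rewrite /A big_ord_recr.
have WS m : W m.+1 = W m + w m by rewrite /W big_ord_recr.
have A0 : A 0%N = 0 by rewrite /A big_ord0.
have W0 : W 0%N = 0 by rewrite /W big_ord0.
pose H i k := Num.min (W i) (A k).
pose z k i := H i.+1 k.+1 - H i.+1 k - (H i k.+1 - H i k).
have z_ge0 k i : 0 <= z k i.
  rewrite /z /H AS WS; move: (a0 k) (w0 i); move: (a k) (w i) (A k) (W i).
  move=> p q s t p0 q0.
  have [?|?] := leP (t + q) (s + p); have [?|?] := leP (t + q) s;
  have [?|?] := leP t (s + p); have [?|?] := leP t s; lra.
(* For [i < k], both [W i] and [W i.+1] lie below [A k], so all four minima are values of [W] and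
   the rectangle increment cancels. *)
have z_up k i : (i < k < n)%N -> z k i = 0.
  move=> /andP[ik kn].
  have h1 : W i <= W i.+1 by rewrite WS lerDl.
  have h2 : W i.+1 <= A i.+1 by apply: le_wa; apply: leq_trans kn; apply: ltnW.
  have h3 : A i.+1 <= A k by apply: psum_le.
  have h4 : A k <= A k.+1 by rewrite AS lerDl.
  rewrite /z /H !min_l; lra.
have z_row k : (k < n)%N -> \sum_(i < n) z k i = a k.
  move=> kn.
  rewrite -(big_mkord xpredT (z k)).
  rewrite (eq_bigr (fun i => (H i.+1 k.+1 - H i.+1 k) - (H i k.+1 - H i k))) //.
  rewrite (telescope_sumr (fun i => H i k.+1 - H i k)) //.
  have h0 : 0 <= A k by rewrite /A sumr_ge0.
  have h1 : A k.+1 <= A n by apply: psum_le.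
  have h2 : W n = A n by [].
  move: (a0 k); rewrite /H h2 W0.
  move: h1; rewrite AS => h1 h3.
  have -> : Num.min (A n) (A k + a k) = A k + a k by apply: min_r.
  have -> : Num.min (A n) (A k) = A k by apply: min_r; lra.
  have -> : Num.min 0 (A k + a k) = 0 by apply: min_l; lra.
  have -> : Num.min 0 (A k) = 0 by apply: min_l.
  lra.
have z_col i : (i < n)%N -> \sum_(k < n) z k i = w i.
  move=> ni.
  rewrite -(big_mkord xpredT (fun k => z k i)).
  rewrite (eq_bigr (fun k => (H i.+1 k.+1 - H i k.+1) - (H i.+1 k - H i k)));
    last by move=> k _; rewrite /z; lra.
  rewrite (telescope_sumr (fun k => H i.+1 k - H i k)) //.
  have h0 : 0 <= W i by rewrite /W sumr_ge0.
  have h1 : W i.+1 <= W n by apply: psum_le.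
  have h2 : W n = A n by [].
  move: (w0 i); rewrite /H -h2 A0.
  move: h1; rewrite WS => h1 h3.
  have -> : Num.min (W i + w i) (W n) = W i + w i by apply: min_l.
  have -> : Num.min (W i) (W n) = W i by apply: min_l; lra.
  have -> : Num.min (W i + w i) 0 = 0 by apply: min_r; lra.
  have -> : Num.min (W i) 0 = 0 by apply: min_r.
  lra.
exists (fun k i => if (k <= i < n)%N then z k i else 0); split.
- by move=> k i; case: ifP.
- by move=> k i /negbTE ->.
- move=> k kn; rewrite -[RHS]z_row //; apply: eq_bigr => i _.
  by rewrite ltn_ord andbT; case: leqP => // ik; rewrite z_up // ik kn.
- move=> i ni; rewrite -[RHS]z_col //; apply: eq_bigr => k _.
  by rewrite ni andbT; case: leqP => // ik; rewrite z_up // ik ltn_ord.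
Qed.

(** A small multiple of the truncated product matrix is set aside; the remaining marginals still
    satisfy the cumulative inequalities and are coupled by [upper_plan_exists]. Adding the multiple
    back gives positivity. *)
Lemma upper_plan_exists_gt0 {R : realType} (n : nat) (a w : nat -> R) :
  (forall k, 0 <= a k) -> (forall i, 0 <= w i) ->
  \sum_(j < n) a j = 1 -> \sum_(j < n) w j = 1 ->
  (forall m, (0 < m < n)%N -> \sum_(j < m) w j < \sum_(j < m) a j) ->
  exists x, upper_plan n a w x /\
    forall k i, (k <= i < n)%N -> 0 < a k -> 0 < w i -> 0 < x k i.
Proof.
move=> a0 w0 a1 w1 lt_wa.
pose gap m := \sum_(j < m) a j - \sum_(j < m) w j.
(* All gaps with [0 < m < n] lie in [(0, 1]], so their product is a positive lower bound for each of
   them. The index 0 is left out because its gap is 0. *)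
pose e := \prod_(m < n | (0 < m)%N) gap m.
have gap_gt0 (m : 'I_n) : (0 < m)%N -> 0 < gap m.
  by move=> m0; rewrite subr_gt0 lt_wa // m0 ltn_ord.
have gap_le1 (m : 'I_n) : gap m <= 1.
  have h1 : \sum_(j < m) a j <= 1 by rewrite -a1 psum_le // ltnW.
  have h2 : 0 <= \sum_(j < m) w j by apply: sumr_ge0.
  rewrite /gap; lra.
have e_gt0 : 0 < e by rewrite /e; apply: prodr_gt0.
have e_le1 : e <= 1.
  by rewrite /e; apply: Num.Theory.prodr_ile1 => m m0; rewrite ltW ?gap_gt0 //=.
have e_gap m : (0 < m < n)%N -> e <= gap m.
  move=> /andP[m0 mn].
  rewrite /e (bigD1 (Ordinal mn)) //= ler_piMr ?(ltW (gap_gt0 (Ordinal mn) m0)) //.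
  apply: Num.Theory.prodr_ile1 => i /andP[i0 _]; rewrite gap_le1 andbT.
  exact/ltW/gap_gt0.
pose p k i := if (k <= i < n)%N then a k * w i else 0.
have p_ge0 k i : 0 <= p k i by rewrite /p; case: ifP => // _; rewrite mulr_ge0.
have p_row k : \sum_(i < n) p k i <= a k.
  apply: (@le_trans _ _ (\sum_(i < n) a k * w i)); last first.
    by rewrite -mulr_sumr w1 mulr1.
  apply: ler_sum => i _; rewrite /p; case: ifP => // _; exact: mulr_ge0.
have p_col i : \sum_(k < n) p k i <= w i.
  apply: (@le_trans _ _ (\sum_(k < n) a k * w i)); last first.
    by rewrite -mulr_suml a1 mul1r.
  apply: ler_sum => k _; rewrite /p; case: ifP => // _; exact: mulr_ge0.
pose a' k := a k - e * \sum_(i < n) p k i.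
pose w' i := w i - e * \sum_(k < n) p k i.
have a'_ge0 k : 0 <= a' k.
  rewrite subr_ge0; apply: le_trans (p_row k).
  by rewrite ler_piMl // sumr_ge0.
have w'_ge0 i : 0 <= w' i.
  rewrite subr_ge0; apply: le_trans (p_col i).
  by rewrite ler_piMl // sumr_ge0.
have eq' : \sum_(j < n) w' j = \sum_(j < n) a' j.
  rewrite !big_split /= a1 w1 !sumrN -!mulr_sumr exchange_big //.
have le' m : (m <= n)%N -> \sum_(j < m) w' j <= \sum_(j < m) a' j.
  move=> mn; have [->|mn'] := eqVneq m n; first by rewrite eq'.
  have [->|m0] := posnP m; first by rewrite !big_ord0.
  have {}mn : (m < n)%N by rewrite ltn_neqAle mn' mn.
  have := e_gap m; rewrite m0 mn => /(_ isT).
  rewrite !big_split /= !sumrN -!mulr_sumr /gap.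
  (* The first [m] rows of [p] have total mass at most 1, so the partial sum of [a] drops by at most
     [e], which the gap absorbs; the partial sum of [w] only decreases. *)
  have h1 : \sum_(k < m) \sum_(i < n) p k i <= 1.
    apply: (@le_trans _ _ (\sum_(k < m) a k)); first exact: ler_sum.
    by rewrite -a1 psum_le // ltnW.
  have h2 : 0 <= \sum_(i < m) \sum_(k < n) p k i.
    by apply: sumr_ge0 => i _; apply: sumr_ge0.
  have := ler_wpM2l (ltW e_gt0) h1.
  have := mulr_ge0 (ltW e_gt0) h2.
  set X := \sum_(j < m) w j; set Y := \sum_(j < m) a j.
  lra.
have [z [z0 zs zr zc]] := upper_plan_exists n a' w' a'_ge0 w'_ge0 le' eq'.
exists (fun k i => z k i + e * p k i); split; first split.
- by move=> k i; rewrite addr_ge0 ?z0 // mulr_ge0 // ltW.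
- by move=> k i ki; rewrite zs // /p (negbTE ki) mulr0 addr0.
- by move=> k kn; rewrite big_split /= zr // -mulr_sumr /a' subrK.
- by move=> i ni; rewrite big_split /= zc // -mulr_sumr /w' subrK.
- move=> k i ki ak wi; rewrite ltr_wpDl ?z0 //.
  by rewrite /p ki !mulr_gt0.
Qed.

(** * One-variable estimates for [t ln (t / q)] *)

Lemma ln_le_subr1 {R : realType} (x : R) : 0 < x -> ln x <= x - 1.
Proof. by move=> x0; have := @le_ln1Dx R (x - 1); rewrite [1 + _]addrC subrK; apply; lra. Qed.

Lemma kl_term0 {R : realType} (q : R) : kl_term 0 q = 0.
Proof. by rewrite /kl_term mul0r. Qed.

(** Convexity as a supporting line at [z]. For [u > 0] it is [ln (z / u) <= z / u - 1] multiplied by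
    [u]; the endpoint [u = 0] is computed directly. *)
Lemma kl_term_tangent {R : realType} (q u z : R) : 0 < q -> 0 < z -> 0 <= u ->
  kl_term z q + (ln (z / q) + 1) * (u - z) <= kl_term u q.
Proof.
move=> q0 z0; rewrite le_eqVlt => /orP[/eqP <-|u0].
  rewrite kl_term0 /kl_term sub0r; set l := ln _; lra.
have : ln (z / u) <= z / u - 1 by apply: ln_le_subr1; rewrite divr_gt0.
rewrite -(ler_pM2l u0) mulrBr mulr1 mulrCA divff ?gt_eqF // mulr1.
by rewrite /kl_term !ln_div ?posrE //; lra.
Qed.

Lemma kl_term_convex {R : realType} (q t x y : R) :
  0 < q -> 0 <= t <= 1 -> 0 <= x -> 0 <= y ->
  kl_term ((1 - t) * x + t * y) q <= (1 - t) * kl_term x q + t * kl_term y q.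
Proof.
move=> q0 /andP[t0 t1] x0 y0.
have s0 : 0 <= 1 - t by rewrite subr_ge0.
have sx0 := mulr_ge0 s0 x0; have ty0 := mulr_ge0 t0 y0.
set z := (1 - t) * x + t * y.
have : 0 <= z by rewrite addr_ge0.
rewrite le_eqVlt => /orP[/eqP z0|z0].
  rewrite -z0 kl_term0 /kl_term !mulrA.
  have -> : (1 - t) * x = 0 by rewrite /z in z0; lra.
  have -> : t * y = 0 by rewrite /z in z0; lra.
  by rewrite !mul0r addr0.
have := ler_wpM2l s0 (kl_term_tangent _ _ _ q0 z0 x0).
have := ler_wpM2l t0 (kl_term_tangent _ _ _ q0 z0 y0).
set k := kl_term z q; set l := ln _ + 1 => h1 h2.
have -> : k = (1 - t) * (k + l * (x - z)) + t * (k + l * (y - z)).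
  by rewrite /z; ring.
lra.
Qed.

(** Isolates the [t ln t] contribution, the source of the infinite slope at 0. *)
Lemma kl_term_scale {R : realType} (q t y : R) : 0 < q -> 0 < t -> 0 <= y ->
  kl_term (t * y) q = t * kl_term y q + t * y * ln t.
Proof.
move=> q0 t0; rewrite le_eqVlt => /orP[/eqP <-|y0].
  by rewrite mulr0 !kl_term0 mulr0 mul0r addr0.
by rewrite /kl_term -[t * y / q]mulrA lnM ?posrE ?divr_gt0 //; ring.
Qed.

(** A Taylor upper bound with explicit remainder, in place of differentiation. It follows from
    [ln s <= s - 1] at [s = (x + d) / x], and is an equality when [x + d = 0]. *)
Lemma kl_term_quadratic {R : realType} (q x d : R) : 0 < q -> 0 < x -> 0 <= x + d ->
  kl_term (x + d) q <= kl_term x q + (ln (x / q) + 1) * d + d ^+ 2 / x.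
Proof.
move=> q0 x0; rewrite le_eqVlt => /orP[/eqP xd|xd].
  rewrite -xd kl_term0 /kl_term.
  have -> : d = - x by lra.
  by rewrite sqrrN expr2 mulfK ?gt_eqF //; lra.
have h : ln ((x + d) / x) <= (x + d) / x - 1 by apply: ln_le_subr1; rewrite divr_gt0.
have := ler_wpM2l (ltW xd) h.
have -> : (x + d) * ((x + d) / x - 1) = d + d ^+ 2 / x by field; rewrite gt_eqF.
by rewrite /kl_term !ln_div ?posrE //; lra.
Qed.

(** * Support and stationarity of entropy-minimizing plans *)

Definition plan_entropy {R : realType} (n : nat) (Q x : nat -> nat -> R) : R :=
  \sum_(k < n) \sum_(i < n) kl_term (x k i) (Q k i).

Lemma le_sum_cell {R : realType} (n k i : nat) (f : nat -> nat -> R) :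
  (forall k i, 0 <= f k i) -> (k < n)%N -> (i < n)%N ->
  f k i <= \sum_(k < n) \sum_(i < n) f k i.
Proof.
move=> f0 kn ni.
rewrite (bigD1 (Ordinal kn)) //= (bigD1 (Ordinal ni)) //= -addrA lerDl.
by rewrite addr_ge0 ?sumr_ge0 // => ? _; rewrite sumr_ge0.
Qed.

Lemma upper_plan_range {R : realType} {n a w} {x : nat -> nat -> R} {k i} :
  upper_plan n a w x -> 0 < x k i -> [/\ (k < n)%N, (i < n)%N & (k <= i)%N].
Proof.
case=> _ xs _ _ xki.
have /andP[ki ni] : (k <= i < n)%N.
  by apply/negPn/negP => /xs xki0; rewrite xki0 ltxx in xki.
by split=> //; apply: leq_ltn_trans ni.
Qed.

(* Moving from x towards y gains t ln t times the mass y puts on the zeros of x,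
   which beats the linear terms for small t. *)
Lemma min_plan_support {R : realType} (n : nat) (a w : nat -> R)
    (Q x y : nat -> nat -> R) :
  (forall k i, 0 < Q k i) -> upper_plan n a w x -> upper_plan n a w y ->
  (forall z, upper_plan n a w z -> plan_entropy n Q x <= plan_entropy n Q z) ->
  forall k i, 0 < y k i -> 0 < x k i.
Proof.
move=> Q0 Px Py xmin k i yki; have [x0 xs xr xc] := Px; have [y0 ys yr yc] := Py.
rewrite lt_neqAle x0 andbT; apply/negP => /eqP xki.
have [kn ni _] := upper_plan_range Py yki.
(* The part of [y] carried by the zeros of [x]; its total mass [Y] is positive because the cell
   [(k, i)] contributes. *)
pose c k i := (x k i == 0)%:R * y k i.
have c0 p q : 0 <= c p q by rewrite mulr_ge0 ?y0.
pose Y := \sum_(k < n) \sum_(i < n) c k i.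
have Y0 : 0 < Y.
  apply: lt_le_trans (le_sum_cell n k i c c0 kn ni).
  by rewrite /c -xki eqxx mul1r.
set Fx := plan_entropy n Q x in xmin; pose Fy := plan_entropy n Q y.
(* Chosen so that [ln t * Y = - (1 + |Fy - Fx|)]: the mixture [z] then has entropy at most [Fx - t],
   contradicting minimality. *)
pose l := - ((1 + `|Fy - Fx|) / Y); pose t := expR l.
have l0 : l <= 0 by rewrite oppr_le0 divr_ge0 ?addr_ge0 // ltW.
have t0 : 0 < t by rewrite expR_gt0.
have t1 : t <= 1 by rewrite -expR0 ler_expR.
have s0 : 0 <= 1 - t by rewrite subr_ge0.
pose z k i := (1 - t) * x k i + t * y k i.
have Pz : upper_plan n a w z.
  split.
  - by move=> p q; rewrite addr_ge0 // mulr_ge0 ?x0 ?y0 // ltW.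
  - by move=> p q pq; rewrite /z xs // ys // !mulr0 addr0.
  - by move=> p pn; rewrite big_split /= -!mulr_sumr xr // yr //; ring.
  - by move=> q qn; rewrite big_split /= -!mulr_sumr xc // yc //; ring.
have cell p q : kl_term (z p q) (Q p q) <=
    (1 - t) * kl_term (x p q) (Q p q) + t * kl_term (y p q) (Q p q) + t * l * c p q.
  rewrite /c /z; have [->|_] := eqVneq (x p q) 0.
    rewrite mulr0 add0r kl_term0 mulr0 add0r kl_term_scale ?y0 ?Q0 //.
    by rewrite /t expRK mul1r; lra.
  rewrite mul0r mulr0 addr0.
  by apply: kl_term_convex => //; rewrite ?x0 ?y0 ?Q0 // (ltW t0) t1.
have : plan_entropy n Q z <= (1 - t) * Fx + t * Fy + t * l * Y.
  rewrite /Fx /Fy /Y /plan_entropy !mulr_sumr -!big_split /=.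
  apply: ler_sum => p _; rewrite !mulr_sumr -!big_split /=.
  by apply: ler_sum => q _.
have := xmin _ Pz.
have -> : t * l * Y = - (t * (1 + `|Fy - Fx|)).
  by rewrite /l mulrN mulNr -mulrA divfK ?gt_eqF.
have : t * (Fy - Fx) <= t * `|Fy - Fx| by rewrite ler_pM2l // ler_norm.
lra.
Qed.

Lemma linear_eq0_of_quadratic_ge0 {R : realType} (S C t0 : R) :
  0 < t0 -> 0 <= C -> (forall t, `|t| <= t0 -> 0 <= t * S + t ^+ 2 * C) -> S = 0.
Proof.
move=> t00 C0 h; apply/eqP/negPn/negP => S0.
have d1 : 0 < 1 + `|S| by rewrite ltr_pwDl.
have d2 : 0 < 1 + C * t0 by rewrite ltr_pwDl // mulr_ge0 // ltW.
(* This size ensures both [s * |S| <= t0] and [s * C < 1]. At [t = - s * S] the quadratic is then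
   [s * S ^+ 2 * (s * C - 1) < 0]. *)
pose s := t0 / ((1 + `|S|) * (1 + C * t0)).
have s0 : 0 < s by rewrite divr_gt0 ?mulr_gt0.
have Ct0 : 0 <= C * t0 by rewrite mulr_ge0 // ltW.
have eqs : s * (1 + `|S|) * (1 + C * t0) = t0.
  by rewrite /s -!mulrA mulVf ?mulr1 // mulf_neq0 ?gt_eqF.
have nS : 0 <= `|S| by [].
have bs : s * `|S| <= t0.
  rewrite -[leRHS]eqs -mulrA; apply: ler_wpM2l; first exact: ltW.
  have := mulr_ge0 nS Ct0; lra.
have bC : s * C < 1.
  have sle : s * (1 + C * t0) <= t0.
    rewrite -[leRHS]eqs; apply: ler_wpM2r; first exact: ltW.
    by rewrite ler_peMr ?lerDl // ltW.
  have : s * C * (1 + C * t0) <= C * t0.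
    by rewrite mulrAC [leRHS]mulrC; apply: ler_wpM2r.
  move=> le1; rewrite -(ltr_pM2r d2) mul1r; lra.
have := h (- (s * S)); rewrite normrN normrM (gtr0_norm s0) => /(_ bs).
have S2 : 0 < S ^+ 2 by rewrite exprn_even_gt0.
have -> : - (s * S) * S + (- (s * S)) ^+ 2 * C = s * S ^+ 2 * (s * C - 1) by ring.
by rewrite (pmulr_rge0 _ (mulr_gt0 s0 S2)) subr_ge0 leNgt bC.
Qed.

(** The perturbation [x + t h] is again a plan for small [t] of either sign, and [kl_term_quadratic]
    bounds its entropy by a quadratic in [t]; minimality forces the linear coefficient to vanish. *)
Lemma min_plan_stationary {R : realType} (n : nat) (a w : nat -> R)
    (Q x h : nat -> nat -> R) :
  (forall k i, 0 < Q k i) -> upper_plan n a w x ->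
  (forall z, upper_plan n a w z -> plan_entropy n Q x <= plan_entropy n Q z) ->
  (forall k i, h k i != 0 -> 0 < x k i) ->
  (forall k, (k < n)%N -> \sum_(i < n) h k i = 0) ->
  (forall i, (i < n)%N -> \sum_(k < n) h k i = 0) ->
  \sum_(k < n) \sum_(i < n) h k i * ln (x k i / Q k i) = 0.
Proof.
move=> Q0 Px xmin hx hr hc; have [x0 xs xr xc] := Px.
(* [B] dominates every ratio [|h| / x], so [|t| <= (1 + B)^-1] keeps [x + t h] nonnegative. *)
pose B := \sum_(k < n) \sum_(i < n) `|h k i| / x k i.
have f0 k i : 0 <= `|h k i| / x k i by rewrite divr_ge0 ?x0.
have B0 : 0 <= B by rewrite sumr_ge0 // => k _; rewrite sumr_ge0.
have d0 : 0 < 1 + B by rewrite ltr_pwDl.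
have hB k i : `|h k i| <= (1 + B) * x k i.
  have [->|hki] := eqVneq (h k i) 0; first by rewrite normr0 mulr_ge0 ?x0 ?ltW.
  have xki := hx _ _ hki; have [kn ni _] := upper_plan_range Px xki.
  rewrite -ler_pdivrMr //; apply: le_trans (le_sum_cell n k i _ f0 kn ni) _.
  by rewrite lerDr.
pose C := \sum_(k < n) \sum_(i < n) h k i ^+ 2 / x k i.
apply: (@linear_eq0_of_quadratic_ge0 R _ C (1 + B)^-1); first by rewrite invr_gt0.
  by rewrite sumr_ge0 // => k _; rewrite sumr_ge0 // => i _; rewrite divr_ge0 ?sqr_ge0 ?x0.
move=> t tB; pose z k i := x k i + t * h k i.
have z0 k i : 0 <= z k i.
  have : `|t * h k i| <= x k i.
    rewrite normrM; apply: le_trans (ler_pM _ _ tB (hB k i)) _ => //.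
    by rewrite mulKf ?gt_eqF.
  by rewrite ler_norml /z => /andP[]; lra.
have Pz : upper_plan n a w z.
  split=> //.
  - move=> k i ki; rewrite /z (xs _ _ ki); have [->|/hx] := eqVneq (h k i) 0.
      by rewrite mulr0 addr0.
    by rewrite (xs _ _ ki) ltxx.
  - by move=> k kn; rewrite big_split /= -mulr_sumr xr // hr // mulr0 addr0.
  - by move=> i ni; rewrite big_split /= -mulr_sumr xc // hc // mulr0 addr0.
have cell k i : kl_term (z k i) (Q k i) <= kl_term (x k i) (Q k i) +
    t * (h k i * ln (x k i / Q k i)) + t * h k i + t ^+ 2 * (h k i ^+ 2 / x k i).
  have [h0|hki] := eqVneq (h k i) 0.
    by rewrite /z h0 !(mulr0, mul0r, expr0n) /= !(mulr0, mul0r, addr0).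
  apply: le_trans (kl_term_quadratic _ _ _ (Q0 _ _) (hx _ _ hki) (z0 k i)) _.
  by rewrite exprMn; lra.
have : plan_entropy n Q z <= plan_entropy n Q x +
    t * (\sum_(k < n) \sum_(i < n) h k i * ln (x k i / Q k i)) +
    t * (\sum_(k < n) \sum_(i < n) h k i) + t ^+ 2 * C.
  rewrite /C /plan_entropy !mulr_sumr -!big_split /=.
  apply: ler_sum => k _; rewrite !mulr_sumr -!big_split /=.
  by apply: ler_sum => i _.
(* The constant 1 in the derivative [ln (x / Q) + 1] drops out because [h] has total mass 0. *)
have -> : \sum_(k < n) \sum_(i < n) h k i = 0.
  by rewrite big1 // => k _; rewrite hr.
rewrite mulr0 addr0; have := xmin _ Pz; lra.
Qed.

(** * Product form of the minimizing plan *)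

Lemma sum_delta {R : realType} (n m : nat) (g : nat -> R) :
  (m < n)%N -> \sum_(i < n) ((i : nat) == m)%:R * g i = g m.
Proof.
move=> mn; rewrite (bigD1 (Ordinal mn)) //= eqxx mul1r big1 ?addr0 // => i im.
by rewrite -val_eqE /= in im; rewrite (negbTE im) mul0r.
Qed.

(* Every row reaches column N, so the 2x2 exchanges between the rows 0, k and
   the columns i, N already determine all the factors. *)
Lemma min_plan_product {R : realType} (N : nat) (a w : nat -> R)
    (Q x : nat -> nat -> R) :
  (forall k, 0 <= a k) -> (forall i, 0 <= w i) ->
  \sum_(j < N.+1) a j = 1 -> \sum_(j < N.+1) w j = 1 ->
  (forall m, (0 < m < N.+1)%N -> \sum_(j < m) w j < \sum_(j < m) a j) ->
  0 < a 0%N -> (forall k i, 0 < Q k i) -> upper_plan N.+1 a w x ->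
  (forall z, upper_plan N.+1 a w z ->
     plan_entropy N.+1 Q x <= plan_entropy N.+1 Q z) ->
  exists D W : nat -> R, [/\ forall k, 0 < D k, forall i, 0 < W i &
    forall k i, (k <= i <= N)%N -> 0 < a k -> 0 < w i ->
      x k i = D k * Q k i * W i].
Proof.
move=> a0 w0 a1 w1 lt_wa a00 Q0 Px xmin.
have x_gt0 k i : (k <= i < N.+1)%N -> 0 < a k -> 0 < w i -> 0 < x k i.
  have [y [Py y0]] := upper_plan_exists_gt0 _ _ _ a0 w0 a1 w1 lt_wa.
  move=> ki ak wi; apply: (min_plan_support _ _ _ _ _ _ Q0 Px Py xmin).
  exact: y0.
(* If [w N] were 0, the first [N] entries of [w] would already sum to 1, against the strict
   inequality at [m = N], or against the empty sum when [N = 0]. *)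
have wN : 0 < w N.
  rewrite lt_neqAle w0 andbT; apply/negP => /eqP wN.
  have := w1; rewrite big_ord_recr /= -wN addr0 => wN1.
  have [N0|N0] := posnP N.
    by move: wN1; rewrite N0 big_ord0 => /eqP; rewrite eq_sym oner_eq0.
  have := lt_wa N; rewrite N0 ltnSn => /(_ isT).
  have := psum_le _ _ _ a0 (leqnSn N); rewrite a1 wN1; lra.
pose L k i := ln (x k i / Q k i).
have ratio k i : (k <= i <= N)%N -> 0 < a k -> 0 < w i ->
    x k i / Q k i * (x 0%N N / Q 0%N N) = x k N / Q k N * (x 0%N i / Q 0%N i).
  move=> /andP[ki iN] ak wi; have kN := leq_trans ki iN.
  (* The exchange direction is the outer product of [s = delta_k - delta_0] and
     [r = delta_i - delta_N]. It has zero row and column sums and lives on four cells where [x] is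
     positive. *)
  pose s p : R := ((p == k)%:R - (p == 0%N)%:R).
  pose r q : R := ((q == i)%:R - (q == N)%:R).
  have sumsE g : \sum_(p < N.+1) s p * g (p : nat) = g k - g 0%N.
    under eq_bigr do rewrite mulrBl.
    by rewrite big_split /= sumrN !sum_delta.
  have sumrE g : \sum_(q < N.+1) r q * g (q : nat) = g i - g N.
    under eq_bigr do rewrite mulrBl.
    by rewrite big_split /= sumrN !sum_delta.
  have delta2 (p m m' : nat) :
      (p == m)%:R - (p == m')%:R != 0 :> R -> p = m \/ p = m'.
    have [->|_] := eqVneq p m; first by left.
    by have [->|_] := eqVneq p m'; [right | rewrite subrr eqxx].
  have [p1 p2 p3 p4] : [/\ 0 < x k i, 0 < x k N, 0 < x 0%N i & 0 < x 0%N N].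
    by split; apply: x_gt0; rewrite ?ltnS ?ki ?kN ?iN ?leqnn.
  have : \sum_(p < N.+1) \sum_(q < N.+1) s p * r q * ln (x p q / Q p q) = 0.
    apply: (min_plan_stationary _ a w _ _ (fun p q => s p * r q)) => //.
    - move=> p q; rewrite mulf_eq0 negb_or => /andP[/delta2 sp /delta2 rq].
      by case: sp rq => -> [] ->.
    - move=> p _; rewrite -mulr_sumr; have := sumrE (fun=> 1).
      by under eq_bigr do rewrite mulr1; rewrite subrr => ->; rewrite mulr0.
    - move=> q _; rewrite -mulr_suml; have := sumsE (fun=> 1).
      by under eq_bigr do rewrite mulr1; rewrite subrr => ->; rewrite mul0r.
  have -> : \sum_(p < N.+1) \sum_(q < N.+1) s p * r q * ln (x p q / Q p q) =
     (L k i - L k N) - (L 0%N i - L 0%N N).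
    rewrite -(sumsE (fun p => L p i - L p N)); apply: eq_bigr => p _.
    rewrite -(sumrE (L p)) mulr_sumr; apply: eq_bigr => q _.
    by rewrite mulrA.
  move=> e; apply: ln_inj; try by rewrite posrE; apply: mulr_gt0; apply: divr_gt0.
  have lnD u v : 0 < u -> 0 < v -> ln (u * v) = ln u + ln v :> R by exact: lnM.
  by rewrite (lnD (_ / _)) ?(lnD (_ / _) (_ / _)) ?divr_gt0 //; move: e; rewrite /L; lra.
(* Column [N] gives the row factors and row 0 the column factors, normalized so that column [N] has
   factor 1. The default 1 covers rows and columns without mass. *)
exists (fun k => if 0 < x k N then x k N / Q k N else 1).
exists (fun i => if 0 < x 0%N i then x 0%N i / Q 0%N i / (x 0%N N / Q 0%N N) else 1).
have x0N : 0 < x 0%N N by apply: x_gt0; rewrite ?ltnSn.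
split.
- by move=> k; case: ifP => // ?; rewrite divr_gt0.
- by move=> i; case: ifP => // ?; rewrite !divr_gt0.
move=> k i kiN ak wi; have := ratio k i kiN ak wi; have [ki iN] := andP kiN.
rewrite !x_gt0 ?ltnS ?ki ?iN ?(leq_trans ki iN) ?leqnn //.
move=> e; rewrite mulrAC !mulrA -[_ * x 0%N i / _](mulrA _ (x 0%N i)).
rewrite -e mulfK ?divfK //; last by rewrite gt_eqF // divr_gt0.
by rewrite gt_eqF.
Qed.

(** * Series with finite support and index shifts *)

Lemma nneseries_finite {R : realType} (m : nat) (f : nat -> R) :
  (forall j, 0 <= f j) -> (forall j, (m <= j)%N -> f j = 0) ->
  (\sum_(j <oo) (f j)%:E = (\sum_(j < m) f j)%:E)%E.
Proof.
move=> f0 fm; rewrite (nneseries_split 0 m) => [|k _]; last by rewrite lee_fin.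
rewrite add0n eseries0 => [|j mj _]; last by rewrite fm.
by rewrite adde0 sumEFin big_mkord.
Qed.

Lemma rel_entropy_finite {R : realType} (m : nat) (p q : nat -> R) :
  (forall j, (m <= j)%N -> p j = 0) ->
  rel_entropy p q = (\sum_(j < m) kl_term (p j) (q j))%:E.
Proof.
move=> pm; rewrite /rel_entropy !(nneseries_finite m).
- rewrite -EFinB; congr EFin; rewrite -sumrB; apply: eq_bigr => j _.
  set k := kl_term _ _; have [?|?] := leP k 0; have [?|?] := leP (- k) 0; lra.
- by move=> j; rewrite le_max lexx orbT.
- by move=> j /pm ->; rewrite kl_term0 oppr0 maxxx.
- by move=> j; rewrite le_max lexx orbT.
- by move=> j /pm ->; rewrite kl_term0 maxxx.
Qed.

Lemma prob_nat_psum_le1 {R : realType} (p : nat -> R) (m : nat) :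
  prob_nat p -> \sum_(j < m) p j <= 1.
Proof.
move=> [p0 p1]; rewrite -lee_fin -p1 -sumEFin -(big_mkord xpredT (fun j => (p j)%:E)).
by apply: nneseries_lim_ge => j _ _; rewrite lee_fin.
Qed.

Lemma sum_shift {R : realType} (n k : nat) (g : nat -> R) : (k <= n)%N ->
  \sum_(i < n) (if (k <= i)%N then g (i - k)%N else 0) = \sum_(j < n - k) g j.
Proof.
move=> kn; rewrite -(big_mkord xpredT (fun i => if (k <= i)%N then g (i - k)%N else 0)).
rewrite (big_cat_nat (n := k)) //= big_nat big1 => [|i /andP[_ ik]]; last first.
  by rewrite leqNgt ik.
rewrite add0r -{1}(add0n k) big_addn big_mkord; apply: eq_bigr => j _.
by rewrite leq_addl addnK.
Qed.

Lemma poisson_pmf_gt0 {R : realType} (b : R) (j : nat) : 0 < b -> 0 < poisson_pmf b j.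
Proof.
move=> b0; rewrite /poisson_pmf b0.
by rewrite mulr_gt0 ?expR_gt0 // divr_gt0 ?exprn_gt0 // ltr0n fact_gt0.
Qed.

(* Pitfall: for [k > I.+1] the value is [g ord0], not 0. *)
Definition nat_ext {R : realType} (I : nat) (g : 'I_I.+2 -> R) (k : nat) : R :=
  g (inord k).

Lemma nat_extE {R : realType} (I : nat) (g : 'I_I.+2 -> R) (k : 'I_I.+2) :
  nat_ext I g k = g k.
Proof. by rewrite /nat_ext inord_val. Qed.

Lemma psum_nat_ext {R : realType} (I m : nat) (g : 'I_I.+2 -> R) :
  (m < I.+2)%N -> \sum_(j < I.+2 | (j <= m)%N) g j = \sum_(j < m.+1) nat_ext I g j.
Proof.
move=> mI; rewrite (big_ord_widen I.+2) //; apply: eq_bigr => j _.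
by rewrite nat_extE.
Qed.

Lemma sum_ord_max0 {R : realType} (I : nat) (f : nat -> R) :
  f I.+1 = 0 -> \sum_(k < I.+2) f k = \sum_(k < I.+1) f k.
Proof. by move=> f0; rewrite big_ord_recr /= f0 addr0. Qed.

(** * Correspondence between admissible kernel families and plans *)

Section PlanOfKernel.
Context {R : realType} (I : nat) (beta : R) (alpha omega : 'I_I.+2 -> R).
Hypotheses (beta_gt0 : 0 < beta) (alpha_simplex : in_simplex alpha)
  (omega_simplex : in_simplex omega)
  (cum : cum_ineq alpha omega) (omega_max0 : omega ord_max = 0)
  (moment : w_moment omega = a_moment alpha + beta).

Let a := nat_ext I alpha.
Let w := nat_ext I omega.

Definition plan_of (pi : 'I_I.+2 -> nat -> R) (k i : nat) : R :=
  if (k <= i < I.+1)%N && (0 < a k) then a k * pi (inord k) (i - k)%N else 0.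

(** Conditional law of the displacement [j = i - k], inverse to [plan_of] on plans. On a row with
    [alpha k = 0] the division returns 0. *)
Definition kernel_of (x : nat -> nat -> R) (k : 'I_I.+2) (j : nat) : R :=
  x k (k + j)%N / alpha k.

(* The junk value 1 keeps the reference measure positive on the empty rows. *)
Definition reference (k i : nat) : R :=
  (if 0 < a k then a k else 1) * poisson_pmf beta (i - k)%N.

Lemma reference_gt0 k i : 0 < reference k i.
Proof. by rewrite mulr_gt0 ?poisson_pmf_gt0 //; case: ifP. Qed.

Lemma a_ge0 k : 0 <= a k.
Proof. by case: alpha_simplex => h _; apply: h. Qed.

Lemma w_ge0 i : 0 <= w i.
Proof. by case: omega_simplex => h _; apply: h. Qed.

Lemma inord_max : inord I.+1 = ord_max :> 'I_I.+2.
Proof. by apply: val_inj; rewrite /= inordK. Qed.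

Lemma w_max0 : w I.+1 = 0.
Proof. by rewrite /w /nat_ext inord_max. Qed.

Lemma sum_w1 : \sum_(i < I.+1) w i = 1.
Proof.
case: omega_simplex => _ <-; rewrite -(sum_ord_max0 _ w w_max0).
by apply: eq_bigr => i _; rewrite /w nat_extE.
Qed.

(** The cumulative inequality at index [I] bounds the mass of [alpha] on [0..I] below by that of
    [omega], which is 1, so nothing is left for index [I.+1]. *)
Lemma sum_a1_max0 : \sum_(k < I.+1) a k = 1 /\ a I.+1 = 0.
Proof.
have : \sum_(k < I.+2) a k = 1.
  case: alpha_simplex => _ <-.
  by apply: eq_bigr => k _; rewrite /a nat_extE.
rewrite big_ord_recr /=; have := a_ge0 I.+1.
have := cum (inord I); rewrite inordK // !psum_nat_ext // => /(_ (leqnn _)).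
rewrite -/a -/w sum_w1; split; lra.
Qed.

Lemma alpha_gt0_range (k : 'I_I.+2) : 0 < alpha k -> (k < I.+1)%N.
Proof.
move=> ak; rewrite ltn_neqAle -ltnS ltn_ord andbT; apply/eqP => kI.
by have := sum_a1_max0.2; rewrite -kI /a nat_extE => e; rewrite e ltxx in ak.
Qed.

Lemma sum_alpha (f : nat -> R) :
  \sum_(k < I.+2 | 0 < alpha k) f k = \sum_(k < I.+1) if 0 < a k then f k else 0.
Proof.
rewrite big_mkcond -(sum_ord_max0 _ (fun k => if 0 < a k then f k else 0)).
  by apply: eq_bigr => k _; rewrite /a nat_extE.
by rewrite sum_a1_max0.2 ltxx.
Qed.

Lemma plan_of_row pi k : (k < I.+1)%N -> 0 < a k ->
  \sum_(i < I.+1) plan_of pi k i = a k * \sum_(j < I.+1 - k) pi (inord k) j.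
Proof.
move=> kI ak; rewrite mulr_sumr -(sum_shift _ _ (fun j => a k * pi (inord k) j)); last exact: ltnW.
by apply: eq_bigr => i _; rewrite /plan_of ltn_ord ak !andbT.
Qed.

Lemma plan_of_ge0 pi k i : (forall k, 0 < alpha k -> prob_nat (pi k)) ->
  0 <= plan_of pi k i.
Proof.
move=> ppi; rewrite /plan_of; case: ifP => // /andP[_ ak].
by rewrite mulr_ge0 ?a_ge0 //; case: (ppi _ ak).
Qed.

Lemma plan_of_col pi i : admissible alpha omega beta pi -> (i < I.+1)%N ->
  \sum_(k < I.+1) plan_of pi k i = w i.
Proof.
move=> [ppi _ col] iI; have iK : (inord i : 'I_I.+2) = i :> nat by rewrite inordK // ltnW.
rewrite /w /nat_ext col iK //.
pose f k := if (k <= i)%N then a k * pi (inord k) (i - k)%N else 0.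
transitivity (\sum_(k < I.+2 | 0 < alpha k) f k); last first.
  by rewrite big_mkcondr; apply: eq_bigr => k _; rewrite /f /a nat_extE inord_val.
rewrite sum_alpha; apply: eq_bigr => k _.
by rewrite /plan_of /f iI andbT; case: (0 < a k); rewrite ?andbT ?andbF.
Qed.

(** A row could only lose mass beyond column [I], so its deficit [d] is nonnegative. The column sums
    add up to 1, as does [a], so the deficits sum to 0 and all vanish. *)
Lemma plan_of_row_admissible pi k : admissible alpha omega beta pi -> (k < I.+1)%N ->
  \sum_(i < I.+1) plan_of pi k i = a k.
Proof.
move=> adm kI; have [ppi _ _] := adm.
pose d k := a k - \sum_(i < I.+1) plan_of pi k i.
have d0 (p : 'I_I.+1) : 0 <= d p.
  rewrite subr_ge0; have [ap|ap] := boolP (0 < a p).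
    rewrite plan_of_row // ler_piMr ?a_ge0 //.
    exact: prob_nat_psum_le1 (ppi _ ap).
  by rewrite big1 ?a_ge0 // => i _; rewrite /plan_of (negbTE ap) andbF.
have sd : \sum_(p < I.+1) d p = 0.
  rewrite big_split /= sumrN exchange_big /= sum_a1_max0.1 -sum_w1.
  rewrite (eq_bigr (fun i : 'I_I.+1 => w i)) ?subrr // => i _.
  by rewrite plan_of_col.
have := psumr_eq0P (fun p _ => d0 p) sd (i := Ordinal kI) isT.
by rewrite /d /=; lra.
Qed.

(** The full row sum says that the values below [I.+1 - k] already have probability 1. *)
Lemma admissible_tail0 pi k j : admissible alpha omega beta pi -> 0 < alpha k ->
  (I.+1 - k <= j)%N -> pi k j = 0.
Proof.
move=> adm ak kj; have [ppi _ _] := adm; have kI := alpha_gt0_range _ ak.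
have ak' : 0 < a k by rewrite /a nat_extE.
have := plan_of_row_admissible _ _ adm kI.
rewrite plan_of_row // inord_val -[RHS]mulr1 => /(mulfI (lt0r_neq0 ak')) s1.
have [p0 _] := ppi _ ak.
have := prob_nat_psum_le1 _ j.+1 (ppi _ ak); rewrite big_ord_recr /=.
have := psum_le _ _ _ p0 kj; rewrite s1; have := p0 j; lra.
Qed.

Lemma plan_of_admissible pi : admissible alpha omega beta pi ->
  upper_plan I.+1 a w (plan_of pi).
Proof.
move=> adm; have [ppi _ _] := adm; split.
- by move=> k i; apply: plan_of_ge0.
- by move=> k i /negbTE ki; rewrite /plan_of ki.
- by move=> k kI; apply: plan_of_row_admissible.
- by move=> i iI; apply: plan_of_col.
Qed.

Lemma objective_plan_of pi :
  (forall k j, 0 < alpha k -> (I.+1 - k <= j)%N -> pi k j = 0) ->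
  objective alpha beta pi = (plan_entropy I.+1 reference (plan_of pi))%:E.
Proof.
move=> tail; rewrite /objective /plan_entropy.
pose f k := a k * \sum_(j < I.+1 - k) kl_term (pi (inord k) j) (poisson_pmf beta j).
transitivity (\sum_(k < I.+2 | (0 < alpha k)%R) (f k)%:E)%E.
  apply: eq_bigr => k ak; rewrite (rel_entropy_finite (I.+1 - k)) => [|j kj].
    by rewrite -EFinM /f /a nat_extE inord_val.
  exact: tail.
rewrite sumEFin sum_alpha; congr EFin; apply: eq_bigr => k _.
have [ak|ak] := boolP (0 < a k); last first.
  by rewrite big1 // => i _; rewrite /plan_of (negbTE ak) andbF kl_term0.
rewrite /f mulr_sumr.
rewrite -(sum_shift _ _
  (fun j => a k * kl_term (pi (inord k) j) (poisson_pmf beta j))); last exact: ltnW.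
apply: eq_bigr => i _; rewrite /plan_of /reference ltn_ord ak !andbT.
case: ifP => _; last by rewrite kl_term0.
by rewrite /kl_term -mulf_div divff ?gt_eqF // mul1r mulrA.
Qed.

Lemma plan_row0 x k i : upper_plan I.+1 a w x -> (k < I.+1)%N -> (i < I.+1)%N ->
  ~~ (0 < a k) -> x k i = 0.
Proof.
move=> [x0 _ xr _] kI iI; rewrite lt_neqAle a_ge0 andbT negbK => /eqP ak.
have := xr _ kI; rewrite -ak => s0.
by have := psumr_eq0P (fun (p : 'I_I.+1) _ => x0 k p) s0 (i := Ordinal iI) isT.
Qed.

Lemma plan_of_kernel_of x k i : upper_plan I.+1 a w x ->
  (k < I.+1)%N -> (i < I.+1)%N -> plan_of (kernel_of x) k i = x k i.
Proof.
move=> Px kI iI; have [_ xs _ _] := Px; rewrite /plan_of /kernel_of.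
have [ki|/negbTE ki] := boolP (k <= i < I.+1)%N; last by rewrite /= xs ?ki.
have [ak|ak] /= := boolP (0 < a k); last by rewrite plan_row0.
rewrite inordK ?(ltnW kI) //; last exact: ltnW.
by rewrite subnKC; [rewrite mulrC divfK ?gt_eqF | case/andP: ki].
Qed.

Lemma kernel_of_tail0 x (k : 'I_I.+2) j : upper_plan I.+1 a w x ->
  (I.+1 - k <= j)%N -> kernel_of x k j = 0.
Proof.
move=> [_ xs _ _] kj; rewrite /kernel_of xs ?mul0r //.
by rewrite negb_and -!ltnNge ltnS -leq_subLR kj orbT.
Qed.

Lemma kernel_of_admissible x : upper_plan I.+1 a w x ->
  admissible alpha omega beta (kernel_of x).
Proof.
move=> Px; have [x0 xs xr xc] := Px.
have ker0 k j : 0 < alpha k -> 0 <= kernel_of x k j.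
  by move=> ak; rewrite divr_ge0 // ltW.
(* One change of variables [i = k + j] serves twice: [g = 1] gives total mass, and [g i = i - k]
   gives the mean displacement. *)
have sumE (g : nat -> R) (k : 'I_I.+2) : 0 < alpha k ->
    alpha k * (\sum_(j < I.+1 - k) g (k + j)%N * kernel_of x k j) =
    \sum_(i < I.+1) g i * x k i.
  move=> ak; have kI := alpha_gt0_range _ ak.
  rewrite mulr_sumr.
  rewrite -(sum_shift _ _ (fun j => alpha k * (g (k + j)%N * kernel_of x k j))); last exact: ltnW.
  apply: eq_bigr => i _; case: leqP => ki.
    by rewrite subnKC // /kernel_of subnKC //; field; rewrite gt_eqF.
  by rewrite xs ?mulr0 // negb_and -ltnNge ki.
split.
- move=> k ak; have kI := alpha_gt0_range _ ak; split=> [j|]; first exact: ker0.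
  rewrite (nneseries_finite (I.+1 - k)) => [|j|j]; [|exact: ker0|exact: kernel_of_tail0].
  congr EFin; apply: (mulfI (lt0r_neq0 ak)); rewrite mulr1.
  have := sumE (fun=> 1) k ak; under eq_bigr do rewrite mul1r.
  by move=> ->; under eq_bigr do rewrite mul1r; rewrite xr // /a nat_extE.
(* The mean displacement is the column moment minus the row moment, which equals [beta] by the
   moment equality. *)
- pose f k := \sum_(i < I.+1) (i%:R - k%:R) * x k i.
  transitivity (\sum_(k < I.+2 | (0 < alpha k)%R) (f k)%:E)%E.
    apply: eq_bigr => k ak; rewrite /nat_mean (nneseries_finite (I.+1 - k)).
    + rewrite -EFinM; congr EFin; apply: etrans (sumE (fun i => i%:R - k%:R) k ak).
      by congr (_ * _); apply: eq_bigr => j _; rewrite natrD addrAC subrr add0r.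
    + by move=> j; rewrite mulr_ge0 ?ker0.
    + by move=> j kj; rewrite kernel_of_tail0 ?mulr0.
  rewrite sumEFin sum_alpha; congr EFin.
  transitivity (\sum_(k < I.+1) (\sum_(i < I.+1) i%:R * x k i - k%:R * a k)).
    apply: eq_bigr => k _; have [ak|ak] := boolP (0 < a k).
      rewrite -(xr k) // mulr_sumr -sumrB.
      by apply: eq_bigr => i _; rewrite mulrBl.
    rewrite -(xr k) // !big1 ?mulr0 ?subrr // => i _; rewrite plan_row0 ?mulr0 //.
  rewrite big_split /= sumrN exchange_big /=.
  have -> : \sum_(k < I.+1) k%:R * a k = a_moment alpha.
    rewrite -(sum_ord_max0 _ (fun k => k%:R * a k)) ?sum_a1_max0.2 ?mulr0 //.
    by apply: eq_bigr => k _; rewrite /a nat_extE.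
  rewrite (eq_bigr (fun i : 'I_I.+1 => i%:R * w i)) => [|i _]; last first.
    by rewrite -mulr_sumr xc.
  rewrite -(sum_ord_max0 _ (fun k => k%:R * w k)) ?w_max0 ?mulr0 //.
  rewrite (eq_bigr (fun i : 'I_I.+2 => i%:R * omega i)) => [|i _]; last first.
    by rewrite /w nat_extE.
  by rewrite -/(w_moment omega) moment addrAC subrr add0r.
- move=> i iI.
  have -> : omega i = w i by rewrite /w nat_extE.
  rewrite -xc ?ltnS // big_mkcondr /=.
  rewrite (eq_bigr (fun k : 'I_I.+2 => x k i)) => [|k ak]; last first.
    case: leqP => ki; last by rewrite xs // negb_and -ltnNge ki.
    by rewrite /kernel_of subnKC // mulrC divfK ?gt_eqF.
  rewrite (sum_alpha (fun k => x k i)); apply: eq_bigr => k _.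
  by case: ifP => // /negbT ak; rewrite plan_row0 // ltnS.
Qed.

(** Every competing plan comes from the admissible family [kernel_of z] with the same entropy, so
    minimality passes from kernels to plans. *)
Lemma plan_of_min pi z : is_minimizer alpha omega beta pi -> upper_plan I.+1 a w z ->
  plan_entropy I.+1 reference (plan_of pi) <= plan_entropy I.+1 reference z.
Proof.
move=> [adm mn] Pz; have := mn _ (kernel_of_admissible _ Pz).
rewrite !objective_plan_of ?lee_fin; first last.
- by move=> k j; apply: admissible_tail0.
- by move=> k j _; apply: kernel_of_tail0.
move/le_trans; apply; rewrite le_eqVlt; apply/orP; left; apply/eqP.
by apply: eq_bigr => k _; apply: eq_bigr => i _; rewrite plan_of_kernel_of.
Qed.

End PlanOfKernel.

(** * Reading the factors off the minimizing plan *)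

Theorem theoremA9 (R : realType) (I : nat) (beta : R) (alpha omega : 'I_I.+2 -> R)
  (pi : 'I_I.+2 -> nat -> R) :
  0 < beta ->
  in_simplex alpha -> in_simplex omega -> 0 < alpha ord0 ->
  feasible alpha omega beta ->
  irreducible alpha omega ->
  w_moment omega = a_moment alpha + beta ->
  omega ord_max = 0 ->
  is_unique_minimizer alpha omega beta pi ->
  exists (D : 'I_I.+2 -> R) (W : nat -> R),
    [/\ forall k, 0 < alpha k -> 0 < D k,
        forall i, in_Iw omega i -> 0 < W i
      & forall (k : 'I_I.+2) (j : nat), 0 < alpha k ->
          pi k j = if in_Iw omega (k + j)%N
                   then D k * poisson_pmf beta j * W (k + j)%N
                   else 0].
Proof.
move=> b0 sa sw a00 [cum _] irr mom wmax [mn _]; have [adm _] := mn.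
have [a1 _] := sum_a1_max0 I alpha omega sa sw cum wmax.
have w1 := sum_w1 I omega sw wmax.
have Px := plan_of_admissible I beta alpha omega sa sw cum wmax pi adm.
(* Sums over [j < m] are cumulative sums through index [m - 1], so irreducibility below [I] covers
   exactly [0 < m < I.+1]. *)
have lt_wa m : (0 < m < I.+1)%N ->
    \sum_(j < m) nat_ext I omega j < \sum_(j < m) nat_ext I alpha j.
  case: m => // m /andP[_ mI].
  have mI2 : (m < I.+2)%N by rewrite ltnW // ltnW.
  by have := irr (inord m); rewrite inordK // !psum_nat_ext //; apply.
have [] := @min_plan_product R I _ _ _ _ (a_ge0 I alpha sa) (w_ge0 I omega sw) a1 w1
  lt_wa _ (reference_gt0 I beta alpha b0) Px
  (fun z => plan_of_min I beta alpha omega sa sw cum wmax mom pi z mn).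
  by rewrite /nat_ext (_ : inord 0 = ord0) //; apply: val_inj; rewrite /= inordK.
move=> D [W [D0 W0 xE]].
exists (fun k => D k), W; split=> // k j ak.
have kI := alpha_gt0_range I alpha omega sa sw cum wmax k ak.
have ak' : 0 < nat_ext I alpha k by rewrite nat_extE.
rewrite /in_Iw wmax ltxx andbF orbF.
have [kjI|kjI] /= := leqP (k + j) I; last first.
  by rewrite (admissible_tail0 I beta alpha omega sa sw cum wmax) // leq_subLR.
have piE : plan_of I alpha pi k (k + j)%N = alpha k * pi k j.
  by rewrite /plan_of leq_addr ltnS kjI ak' /= inord_val nat_extE addKn.
have [wi|wi] := boolP (0 < omega (inord (k + j)%N)).
  apply: (mulfI (lt0r_neq0 ak)); rewrite -piE xE ?leq_addr ?kjI //.
  by rewrite /reference ak' addKn nat_extE; ring.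
(* A column with [omega_i = 0] has nonnegative entries summing to 0, so [pi k j] vanishes there. *)
have [x0 _ _ xc] := Px.
have := xc (k + j)%N; rewrite ltnS => /(_ kjI).
have -> : nat_ext I omega (k + j) = 0.
  by apply/eqP; rewrite eq_le w_ge0 // andbT leNgt.
move=> s0; have := psumr_eq0P (fun (p : 'I_I.+1) _ => x0 p (k + j)%N) s0 (i := Ordinal kI) isT.
by rewrite /= piE => /eqP; rewrite mulf_eq0 gt_eqF //= => /eqP.
Qed.
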